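(* Let $\Gamma$ be a Coxeter graph with finite vertex set, let $VA[\Gamma]$ be the associated virtual Artin group, $PVA[\Gamma]$ its pure virtual Artin group, and $\Phi[\Gamma]$ the root system of $\Gamma$. Then the group $PVA[\Gamma]/PVA[\Gamma]'$, where $PVA[\Gamma]'$ is the commutator subgroup of $PVA[\Gamma]$, is a free abelian group of rank $|\Phi[\Gamma]|$.
   Context: Coxeter data. A Coxeter matrix on a finite set $S$ is a symmetric matrix $(m_{s,t})_{s,t\in S}$ with entries in $\mathbb{N}\cup\{\infty\}$, $m_{s,s}=1$, and $m_{s,t}=m_{t,s}\ge 2$ for $s\ne t$. It is encoded by its Coxeter graph $\Gamma$ (vertex set $S$; edge $\{s,t\}$ iff $m_{s,t}\ge 3$, labelled by $m_{s,t}$ if $m_{s,t}\ge4$). For group elements $x,y$ and $m\ge1$, $\mathrm{Prod}_R(x,y,m)$ denotes the alternating word $\cdots yxy$ of length $m$ (rightmost letter $y$). The Coxeter group $W[\Gamma]$ is generated by $S$ with relations $s^2=1$ for all $s\in S$ and $\mathrm{Prod}_R(t,s,m_{s,t})=\mathrm{Prod}_R(s,t,m_{s,t})$ for $s\neq t$ with $m_{s,t}<\infty$. Virtual Artin group. $VA[\Gamma]$ is the group generated by $\{\sigma_s\mid s\in S\}\sqcup\{\tau_s\mid s\in S\}$ with relations: (1) $\mathrm{Prod}_R(\sigma_t,\sigma_s,m_{s,t})=\mathrm{Prod}_R(\sigma_s,\sigma_t,m_{s,t})$ for $s\ne t$, $m_{s,t}<\infty$; (2) $\mathrm{Prod}_R(\tau_t,\tau_s,m_{s,t})=\mathrm{Prod}_R(\tau_s,\tau_t,m_{s,t})$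 for $s\neq t$, $m_{s,t}<\infty$, and $\tau_s^2=1$ for $s\in S$; (3) $\mathrm{Prod}_R(\tau_s,\tau_t,m_{s,t}-1)\,\sigma_s=\sigma_r\,\mathrm{Prod}_R(\tau_s,\tau_t,m_{s,t}-1)$ for $s\ne t$, $m_{s,t}<\infty$, where $r=s$ if $m_{s,t}$ is even and $r=t$ if $m_{s,t}$ is odd. The pure virtual Artin group $PVA[\Gamma]$ is the kernel of the surjection $\pi_P: VA[\Gamma]\to W[\Gamma]$, $\pi_P(\sigma_s)=\pi_P(\tau_s)=s$. Root system. Let $V$ be the real vector space with basis $\{\alpha_s\mid s\in S\}$ and symmetric bilinear form $\langle\alpha_s,\alpha_t\rangle=-2\cos(\pi/m_{s,t})$ if $m_{s,t}<\infty$ and $-2$ if $m_{s,t}=\infty$. The Tits representation $\rho: W[\Gamma]\to \mathrm{GL}(V)$ is $\rho(s)(v)=v-\langle v,\alpha_s\rangle\alpha_s$. The root system is $\Phi[\Gamma]=\{\rho(w)(\alpha_s)\mid s\in S, w\in W[\Gamma]\}$ (possibly infinite). *)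

(* Defs.v *)
From HB Require Import structures.
From mathcomp Require Import all_boot all_order all_algebra.
From mathcomp Require Import boolp classical_sets reals trigo.
From mathcomp Require Import freeg.
From mathcomp Require Import ring lra.

Set Implicit Arguments.
Unset Strict Implicit.
Unset Printing Implicit Defensive.

Import Order.TTheory GRing.Theory Num.Theory.

Local Open Scope group_scope.
Local Open Scope quotient_scope.

Section Subgroups.
Variable G : groupType.

Definition normal_closed (N : {pred G}) :=
  forall x y : G, x \in N -> x ^ y \in N.

Definition generated (A : set G) : {pred G} :=
  [pred x | `[< forall H : {pred G},
     group_closed H -> (forall a, A a -> a \in H) -> x \in H >]].

Definition normal_closure (A : set G) : {pred G} :=
  [pred x | `[< forall N : {pred G},
     group_closed N -> normal_closed N -> (forall a, A a -> a \in N) ->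
     x \in N >]].

Lemma generatedP (A : set G) x :
  x \in generated A <-> forall H : {pred G},
    group_closed H -> (forall a, A a -> a \in H) -> x \in H.
Proof. by split => [/asboolP|xA]; last exact/asboolP. Qed.

Lemma normal_closureP (A : set G) x :
  x \in normal_closure A <-> forall N : {pred G},
    group_closed N -> normal_closed N -> (forall a, A a -> a \in N) ->
    x \in N.
Proof. by split => [/asboolP|xA]; last exact/asboolP. Qed.

Lemma generated_group_closed A : group_closed (generated A).
Proof.
split=> [|x y /generatedP xA /generatedP yA]; apply/generatedP => H cH AH.
  by case: cH.
by case: (cH) => _; apply; [exact: xA | exact: yA].
Qed.

Lemma normal_closure_group_closed A : group_closed (normal_closure A).
Proof.
split=> [|x y /normal_closureP xA /normal_closureP yA];
  apply/normal_closureP => N cN nN AN.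
  by case: cN.
by case: (cN) => _; apply; [exact: xA | exact: yA].
Qed.

Lemma normal_closure_normal A : normal_closed (normal_closure A).
Proof.
move=> x y /normal_closureP xA; apply/normal_closureP => N cN nN AN.
exact/nN/xA.
Qed.

Lemma sub_generated (A : set G) a : A a -> a \in generated A.
Proof. by move=> Aa; apply/generatedP => H _; apply. Qed.

Lemma sub_normal_closure (A : set G) a : A a -> a \in normal_closure A.
Proof. by move=> Aa; apply/normal_closureP => N _ _; apply. Qed.

Record normalSubgroup := NormalSubgroup {
  ns_pred :> {pred G};
  ns_group : group_closed ns_pred;
  ns_normal : normal_closed ns_pred
}.

Definition normal_closure_ns (A : set G) : normalSubgroup :=
  NormalSubgroup (@normal_closure_group_closed A) (@normal_closure_normal A).

Definition derived : {pred G} :=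
  generated [set z | exists x y : G, z = [~ x, y]].

Lemma derived_normal : normal_closed derived.
Proof.
move=> x y xD; have -> : x ^ y = x * [~ x, y] by rewrite commgEl mulgA mulgV mul1g.
have cD : group_closed derived by exact: generated_group_closed.
by apply: group_closedM => //; apply: sub_generated; exists x, y.
Qed.

Definition derived_ns : normalSubgroup :=
  NormalSubgroup (@generated_group_closed _) derived_normal.

End Subgroups.

Section Quotient.
Variables (G : groupType) (N : normalSubgroup G).

Definition coset_eq (x y : G) : bool := x^-1 * y \in (N : {pred G}).

Let N1 : 1 \in (N : {pred G}). Proof. by case: (ns_group N). Qed.
Let NM x y : x \in (N : {pred G}) -> y \in (N : {pred G}) ->
  x * y \in (N : {pred G}).
Proof. exact: (group_closedM (ns_group N)). Qed.
Let NV x : x \in (N : {pred G}) -> x^-1 \in (N : {pred G}).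
Proof. exact: (group_closedV (ns_group N)). Qed.

Fact coset_eq_refl : reflexive coset_eq.
Proof. by move=> x; rewrite /coset_eq mulVg. Qed.

Fact coset_eq_sym : symmetric coset_eq.
Proof.
by move=> x y; apply/idP/idP => /NV; rewrite /coset_eq invgM invgK.
Qed.

Fact coset_eq_trans : transitive coset_eq.
Proof. by move=> y x z xy yz; have := NM xy yz; rewrite mulgA mulgK. Qed.

Canonical coset_eq_equiv :=
  EquivRel coset_eq coset_eq_refl coset_eq_sym coset_eq_trans.
Canonical coset_eq_encModRel := defaultEncModRel coset_eq.

Definition quotient_group := {eq_quot coset_eq}.

HB.instance Definition _ := EqQuotient.on quotient_group.
HB.instance Definition _ := Choice.on quotient_group.

Definition quot (x : G) : quotient_group := \pi_quotient_group x.

Lemma quot_eqP x y : quot x = quot y <-> x^-1 * y \in (N : {pred G}).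
Proof. by split => [/eqmodP|?]; last exact/eqmodP. Qed.

Lemma quot_ind (P : quotient_group -> Prop) :
  (forall x, P (quot x)) -> forall u, P u.
Proof. by move=> Px u; rewrite -[u]reprK; exact: Px. Qed.

Let repr_quot x : coset_eq (repr (quot x)) x.
Proof. by apply/eqmodP; rewrite reprK. Qed.

Definition quot_mul (u v : quotient_group) := quot (repr u * repr v).
Definition quot_inv (u : quotient_group) := quot (repr u)^-1.

Lemma quotM_subproof x y : quot_mul (quot x) (quot y) = quot (x * y).
Proof.
apply/quot_eqP; rewrite invgM.
move: (repr_quot x) (repr_quot y); rewrite /coset_eq.
set a := repr _; set b := repr _ => ax bx.
have -> : b^-1 * a^-1 * (x * y) = (a^-1 * x) ^ b * (b^-1 * y).
  by rewrite conjgE !mulgA mulgK.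
by apply: NM => //; apply: ns_normal.
Qed.

Lemma quotV_subproof x : quot_inv (quot x) = quot x^-1.
Proof.
apply/quot_eqP; rewrite invgK.
have := repr_quot x; rewrite /coset_eq; set a := repr _ => ax.
have -> : a * x^-1 = ((a^-1 * x) ^ x^-1)^-1.
  by rewrite conjgE invgK mulgK invgM invgK.
by apply/NV/ns_normal.
Qed.

Let quot_mulA : associative quot_mul.
Proof.
elim/quot_ind => x; elim/quot_ind => y; elim/quot_ind => z.
by rewrite !quotM_subproof mulgA.
Qed.

Let quot_mul1 : left_id (quot 1) quot_mul.
Proof. by elim/quot_ind => x; rewrite quotM_subproof mul1g. Qed.

Let quot_mulr1 : right_id (quot 1) quot_mul.
Proof. by elim/quot_ind => x; rewrite quotM_subproof mulg1. Qed.

Let quot_mulV : left_inverse (quot 1) quot_inv quot_mul.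
Proof.
by elim/quot_ind => x; rewrite quotV_subproof quotM_subproof mulVg.
Qed.

Let quot_mulrV : right_inverse (quot 1) quot_inv quot_mul.
Proof.
by elim/quot_ind => x; rewrite quotV_subproof quotM_subproof mulgV.
Qed.

HB.instance Definition _ := isGroup.Build quotient_group
  quot_mulA quot_mul1 quot_mulr1 quot_mulV quot_mulrV.

Lemma quotM : {morph quot : x y / x * y}.
Proof. by move=> x y; rewrite -quotM_subproof. Qed.

HB.instance Definition _ := isMultiplicative.Build G quotient_group quot quotM.

End Quotient.

Definition abelianization (G : groupType) := quotient_group (derived_ns G).
HB.instance Definition _ (G : groupType) := Group.on (abelianization G).

Section Kernel.
Variables (G H : groupType) (f : {multiplicative G -> H}).

Definition kernel_pred : {pred G} := [pred x | f x == 1].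

Let f1 : f 1 = 1.
Proof. by apply: (@mulgI _ (f 1)); rewrite -gmulfM !mulg1. Qed.

Lemma kernel_group_closed : group_closed kernel_pred.
Proof.
split=> [|x y]; rewrite !inE ?f1 // => /eqP fx /eqP fy.
have fV : f y^-1 = 1 by rewrite -[LHS]mul1g -[in LHS]fy -gmulfM mulgV f1.
by rewrite gmulfM fx fV mulg1.
Qed.

Definition kernel := {x : G | x \in kernel_pred}.

HB.instance Definition _ := SubChoice.on kernel.
HB.instance Definition _ :=
  SubChoice_isSubGroup.Build G kernel_pred kernel kernel_group_closed.

End Kernel.

Section FreeGroup.
Variable X : choiceType.

(* The letter [(x, false)] stands for x and [(x, true)] for its inverse. *)
Notation word := (seq (X * bool)).

Definition letterV (l : X * bool) : X * bool := (l.1, ~~ l.2).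

Inductive word_equiv : word -> word -> Prop :=
| word_equiv_refl u : word_equiv u u
| word_equiv_sym u v : word_equiv u v -> word_equiv v u
| word_equiv_trans u v w : word_equiv u v -> word_equiv v w -> word_equiv u w
| word_equiv_cancel u v l : word_equiv (u ++ [:: l; letterV l] ++ v) (u ++ v).

Definition word_eq (u v : word) : bool := `[< word_equiv u v >].

Fact word_eq_refl : reflexive word_eq.
Proof. by move=> u; apply/asboolP; constructor. Qed.

Fact word_eq_sym : symmetric word_eq.
Proof. by move=> u v; apply/asboolP/asboolP; apply: word_equiv_sym. Qed.

Fact word_eq_trans : transitive word_eq.
Proof.
by move=> v u w /asboolP uv /asboolP vw; apply/asboolP/(word_equiv_trans uv).
Qed.

Canonical word_eq_equiv :=
  EquivRel word_eq word_eq_refl word_eq_sym word_eq_trans.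
Canonical word_eq_encModRel := defaultEncModRel word_eq.

Definition free_group := {eq_quot word_eq}.

HB.instance Definition _ := EqQuotient.on free_group.
HB.instance Definition _ := Choice.on free_group.

Definition free_of_word (u : word) : free_group := \pi_free_group u.

Lemma free_of_word_eqP u v :
  free_of_word u = free_of_word v <-> word_equiv u v.
Proof.
by split=> [/eqmodP/asboolP|uv]; last exact/eqmodP/asboolP.
Qed.

Lemma free_of_word_ind (P : free_group -> Prop) :
  (forall u, P (free_of_word u)) -> forall x, P x.
Proof. by move=> Pu x; rewrite -[x]reprK; exact: Pu. Qed.

Let repr_word u : word_equiv (repr (free_of_word u)) u.
Proof. by apply/free_of_word_eqP; rewrite /free_of_word reprK. Qed.

Definition wordV (u : word) : word := rev (map letterV u).

Lemma letterVK : involutive letterV.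
Proof. by case=> x b; rewrite /letterV /= negbK. Qed.

Lemma wordVK : involutive wordV.
Proof.
by move=> u; rewrite /wordV map_rev revK -map_comp (eq_map letterVK) map_id.
Qed.

Lemma word_equiv_catl w u v : word_equiv u v -> word_equiv (w ++ u) (w ++ v).
Proof.
elim=> {u v} [u|u v _|u v w' _ uv _|u v l]; first exact: word_equiv_refl.
- exact: word_equiv_sym.
- exact: word_equiv_trans.
- by rewrite !(catA w); apply: word_equiv_cancel.
Qed.

Lemma word_equiv_catr w u v : word_equiv u v -> word_equiv (u ++ w) (v ++ w).
Proof.
elim=> {u v} [u|u v _|u v w' _ uv _|u v l]; first exact: word_equiv_refl.
- exact: word_equiv_sym.
- exact: word_equiv_trans.
- by rewrite -!catA; apply: word_equiv_cancel.
Qed.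

Lemma word_equivV u v : word_equiv u v -> word_equiv (wordV u) (wordV v).
Proof.
elim=> {u v} [u|u v _|u v w' _ uv _|u v l]; first exact: word_equiv_refl.
- exact: word_equiv_sym.
- exact: word_equiv_trans.
- rewrite /wordV !map_cat !rev_cat -!catA.
  have := word_equiv_cancel (rev (map letterV v)) (rev (map letterV u)) l.
  by rewrite /= /rev /= letterVK.
Qed.

Lemma wordVM u : word_equiv (wordV u ++ u) [::].
Proof.
elim: u => [|l u IH]; first exact: word_equiv_refl.
apply: word_equiv_trans IH; rewrite /wordV /= rev_cons cat_rcons.
by have := word_equiv_cancel (rev (map letterV u)) u (letterV l);
  rewrite letterVK.
Qed.

Definition free_mul (x y : free_group) := free_of_word (repr x ++ repr y).
Definition free_inv (x : free_group) := free_of_word (wordV (repr x)).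

Lemma free_mulE u v :
  free_mul (free_of_word u) (free_of_word v) = free_of_word (u ++ v).
Proof.
apply/free_of_word_eqP; apply: (@word_equiv_trans _ (u ++ repr (free_of_word v))).
  exact: word_equiv_catr.
exact: word_equiv_catl.
Qed.

Lemma free_invE u : free_inv (free_of_word u) = free_of_word (wordV u).
Proof. exact/free_of_word_eqP/word_equivV. Qed.

Let free_mulA : associative free_mul.
Proof.
elim/free_of_word_ind => u; elim/free_of_word_ind => v.
by elim/free_of_word_ind => w; rewrite !free_mulE catA.
Qed.

Let free_mul1 : left_id (free_of_word [::]) free_mul.
Proof. by elim/free_of_word_ind => u; rewrite free_mulE. Qed.

Let free_mulr1 : right_id (free_of_word [::]) free_mul.
Proof. by elim/free_of_word_ind => u; rewrite free_mulE cats0. Qed.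

Let free_mulV : left_inverse (free_of_word [::]) free_inv free_mul.
Proof.
elim/free_of_word_ind => u; rewrite free_invE free_mulE.
exact/free_of_word_eqP/wordVM.
Qed.

Let free_mulrV : right_inverse (free_of_word [::]) free_inv free_mul.
Proof.
elim/free_of_word_ind => u; rewrite free_invE free_mulE.
by apply/free_of_word_eqP; rewrite -{1}[u]wordVK; exact: wordVM.
Qed.

HB.instance Definition _ := isGroup.Build free_group
  free_mulA free_mul1 free_mulr1 free_mulV free_mulrV.

Definition free_gen (x : X) : free_group := free_of_word [:: (x, false)].

Lemma free_of_word_nil : free_of_word [::] = 1.
Proof. by []. Qed.

Lemma free_of_word_cat u v :
  free_of_word (u ++ v) = free_of_word u * free_of_word v.
Proof. by rewrite -free_mulE. Qed.

Section Lift.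
Variables (H : groupType) (f : X -> H).

Definition letter_val (l : X * bool) : H := if l.2 then (f l.1)^-1 else f l.1.

Definition word_val (u : word) : H := \prod_(l <- u) letter_val l.

Lemma word_val_equiv u v : word_equiv u v -> word_val u = word_val v.
Proof.
elim=> {u v} [u|u v _ -> //|u v w _ -> _ -> //|u v [x b]] //.
rewrite /word_val !big_cat !big_cons big_nil /letter_val /=.
by case: b; rewrite /= mulg1 ?mulVg ?mulgV mul1g.
Qed.

Definition free_lift (x : free_group) : H := word_val (repr x).

Lemma free_lift_of_word u : free_lift (free_of_word u) = word_val u.
Proof. exact: word_val_equiv. Qed.

Lemma free_liftM : {morph free_lift : x y / x * y}.
Proof.
elim/free_of_word_ind => u; elim/free_of_word_ind => v.
by rewrite -free_of_word_cat !free_lift_of_word /word_val big_cat.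
Qed.

HB.instance Definition _ :=
  isMultiplicative.Build free_group H free_lift free_liftM.

Lemma free_lift_gen x : free_lift (free_gen x) = f x.
Proof. by rewrite free_lift_of_word /word_val big_seq1. Qed.

Lemma free_lift1 : free_lift 1 = 1.
Proof. by rewrite -free_of_word_nil free_lift_of_word /word_val big_nil. Qed.

Lemma free_liftV x : free_lift x^-1 = (free_lift x)^-1.
Proof.
by apply: (@mulgI _ (free_lift x)); rewrite -free_liftM !mulgV free_lift1.
Qed.

End Lift.
End FreeGroup.

(* [presented R] is the group < X | u = v for all u, v with R u v >. *)
Section Presentation.
Variables (X : choiceType) (R : free_group X -> free_group X -> Prop).

Definition relators : set (free_group X) :=
  [set w | exists u v, R u v /\ w = u * v^-1].

Definition presented := quotient_group (normal_closure_ns relators).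
HB.instance Definition _ := Group.on presented.

Definition pres_proj (u : free_group X) : presented := quot _ u.

Lemma pres_projM : {morph pres_proj : x y / x * y}.
Proof. exact: quotM. Qed.

HB.instance Definition _ :=
  isMultiplicative.Build (free_group X) presented pres_proj pres_projM.

Definition pres_gen (x : X) : presented := pres_proj (free_gen x).

Lemma pres_rel u v : R u v -> pres_proj u = pres_proj v.
Proof.
move=> Ruv; apply/quot_eqP.
have cN := normal_closure_group_closed relators.
have : (u * v^-1)^-1 \in normal_closure relators.
  by apply: (group_closedV cN); apply: sub_normal_closure; exists u, v.
rewrite invgM invgK => uvN.
have := normal_closure_normal u uvN.
by rewrite conjgE mulgVK.
Qed.

Section Lift.
Variables (H : groupType) (f : X -> H).
Hypothesis fR : forall u v, R u v -> free_lift f u = free_lift f v.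

Definition pres_lift (x : presented) : H := free_lift f (repr x).

Lemma pres_lift_proj u : pres_lift (pres_proj u) = free_lift f u.
Proof.
have /quot_eqP : quot (normal_closure_ns relators) (repr (pres_proj u))
  = quot _ u by rewrite /quot reprK.
rewrite /pres_lift; set w := repr _ => wN.
have /normal_closureP := wN => /(_ [pred x | free_lift f x == 1]).
rewrite inE free_liftM free_liftV => /(_ _ _ _)/eqP wu.
apply: (@mulgI _ (free_lift f w)^-1); rewrite mulVg wu //.
- split=> [|x y]; rewrite !inE ?free_lift1 // => /eqP fx /eqP fy.
  by rewrite free_liftM free_liftV fx fy invg1 mulg1.
- move=> x y; rewrite !inE => /eqP fx.
  by rewrite conjgE !free_liftM free_liftV fx mul1g mulVg.
- move=> _ [a [b [Rab ->]]]; rewrite inE free_liftM free_liftV.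
  by rewrite (fR Rab) mulgV.
Qed.

Lemma pres_lift_gen x : pres_lift (pres_gen x) = f x.
Proof. by rewrite pres_lift_proj free_lift_gen. Qed.

Lemma pres_liftM : {morph pres_lift : x y / x * y}.
Proof.
elim/quot_ind => u; elim/quot_ind => v.
have := pres_lift_proj (u * v); rewrite /pres_proj quotM => ->.
by rewrite free_liftM -!pres_lift_proj.
Qed.

End Lift.
End Presentation.

(* This is the same data as the Coxeter graph: {s, t} is an edge iff s != t and
   M s t is not [Some 2], labelled by M s t. [None] is the entry infinity. *)
Record coxeterMatrix (S : finType) := CoxeterMatrix {
  cox_m :> S -> S -> option nat;
  cox_diag : forall s, cox_m s s = Some 1%N;
  cox_sym : forall s t, cox_m s t = cox_m t s;
  cox_ge2 : forall s t k, s != t -> cox_m s t = Some k -> (2 <= k)%N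
}.

(* The alternating word ... y x y of length m, ending with y on the right. *)
Fixpoint prodR (G : groupType) (x y : G) (m : nat) : G :=
  if m is n.+1 then prodR y x n * y else 1.

Lemma gmulf_prodR (G H : groupType) (f : {multiplicative G -> H}) x y m :
  f (prodR x y m) = prodR (f x) (f y) m.
Proof.
elim: m x y => [|m IH] x y /=; last by rewrite gmulfM IH.
by apply: (@mulgI _ (f 1)); rewrite -gmulfM !mulg1.
Qed.

Lemma prodRSl (G : groupType) (x y : G) m :
  prodR x y m.+1 = (if odd m then x else y) * prodR x y m.
Proof.
elim: m x y => [|m IH] x y; first by rewrite /= mul1g mulg1.
rewrite -[LHS]/(prodR y x m.+1 * y) IH -mulgA.
by rewrite -[prodR y x m * y]/(prodR x y m.+1) /=; case: (odd m).
Qed.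

Section CoxeterGroup.
Variables (S : finType) (M : coxeterMatrix S).

Inductive coxeter_rel : free_group S -> free_group S -> Prop :=
| coxeter_rel_sq s : coxeter_rel (free_gen s ^+ 2) 1
| coxeter_rel_braid s t k : s != t -> M s t = Some k ->
    coxeter_rel (prodR (free_gen t) (free_gen s) k)
                (prodR (free_gen s) (free_gen t) k).

Definition coxeter_group := presented coxeter_rel.
HB.instance Definition _ := Group.on coxeter_group.

Definition coxeter_gen (s : S) : coxeter_group := pres_gen coxeter_rel s.

Lemma coxeter_gen_sq s : coxeter_gen s ^+ 2 = 1.
Proof.
have := pres_rel (coxeter_rel_sq s).
by rewrite !expgS expg0 !mulg1 /pres_proj quotM => ->.
Qed.

Lemma coxeter_gen_braid s t k : s != t -> M s t = Some k ->
  prodR (coxeter_gen t) (coxeter_gen s) k =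
  prodR (coxeter_gen s) (coxeter_gen t) k.
Proof.
move=> st Mst; have := pres_rel (coxeter_rel_braid st Mst).
by rewrite !(gmulf_prodR (pres_proj coxeter_rel)).
Qed.

End CoxeterGroup.

Section VirtualArtin.
Variables (S : finType) (M : coxeterMatrix S).

(* Free generators: [inl s] is sigma_s and [inr s] is tau_s. *)
Definition sigma_word (s : S) : free_group (S + S)%type := free_gen (inl s).
Definition tau_word (s : S) : free_group (S + S)%type := free_gen (inr s).

Inductive va_rel : free_group (S + S)%type -> free_group (S + S)%type -> Prop :=
| va_rel_sigma s t k : s != t -> M s t = Some k ->
    va_rel (prodR (sigma_word t) (sigma_word s) k) (prodR (sigma_word s) (sigma_word t) k)
| va_rel_tau s t k : s != t -> M s t = Some k ->
    va_rel (prodR (tau_word t) (tau_word s) k) (prodR (tau_word s) (tau_word t) k)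
| va_rel_tau_sq s : va_rel (tau_word s ^+ 2) 1
| va_rel_mixed s t k : s != t -> M s t = Some k ->
    va_rel (prodR (tau_word s) (tau_word t) k.-1 * sigma_word s)
           (sigma_word (if odd k then t else s) * prodR (tau_word s) (tau_word t) k.-1).

Definition virtual_artin := presented va_rel.
HB.instance Definition _ := Group.on virtual_artin.

Definition va_to_coxeter_gen (x : S + S) : coxeter_group M :=
  match x with inl s | inr s => coxeter_gen M s end.

Lemma va_to_coxeter_rel u v : va_rel u v ->
  free_lift va_to_coxeter_gen u = free_lift va_to_coxeter_gen v.
Proof.
have fs s : free_lift va_to_coxeter_gen (sigma_word s) = coxeter_gen M s.
  by rewrite free_lift_gen.
have ft s : free_lift va_to_coxeter_gen (tau_word s) = coxeter_gen M s.
  by rewrite free_lift_gen.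
have fprod x y k : free_lift va_to_coxeter_gen (prodR x y k) =
    prodR (free_lift va_to_coxeter_gen x) (free_lift va_to_coxeter_gen y) k.
  exact: (gmulf_prodR (free_lift va_to_coxeter_gen)).
case=> {u v} [s t k st Mst|s t k st Mst|s|s t k st Mst].
- by rewrite !fprod !fs; apply: coxeter_gen_braid.
- by rewrite !fprod !ft; apply: coxeter_gen_braid.
- rewrite !expgS expg0 mulg1 free_liftM free_lift1 ft.
  by have := coxeter_gen_sq M s; rewrite !expgS expg0 mulg1.
- rewrite !free_liftM !fprod !fs !ft.
  have : (0 < k)%N by apply: leq_trans (cox_ge2 st Mst).
  case: k Mst => // k Mst _ /=.
  have := coxeter_gen_braid st Mst; rewrite /= => ->.
  rewrite -[LHS]/(prodR (coxeter_gen M s) (coxeter_gen M t) k.+1) prodRSl.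
  by case: (odd k).
Qed.

Definition piP : virtual_artin -> coxeter_group M :=
  pres_lift va_to_coxeter_gen.

Lemma piPM : {morph piP : x y / x * y}.
Proof. exact: pres_liftM va_to_coxeter_rel. Qed.

HB.instance Definition _ :=
  isMultiplicative.Build virtual_artin (coxeter_group M) piP piPM.

Lemma piP_gen x : piP (pres_gen va_rel x) = va_to_coxeter_gen x.
Proof. exact: pres_lift_gen va_to_coxeter_rel x. Qed.

Definition pure_virtual_artin := kernel piP.
HB.instance Definition _ := Group.on pure_virtual_artin.

End VirtualArtin.

Section GeneralLinear.
Variables (K : fieldType) (V : vectType K).

(* Linear endomorphisms with zero kernel: V is finite dimensional. *)
Definition GL := {f : 'End(V) | lker f == 0%VS}.
HB.instance Definition _ := SubChoice.on GL.

Definition GL_fun (f : GL) : 'End(V) := val f.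

Fact GL_one_subproof : lker (\1%VF : 'End(V)) == 0%VS.
Proof. by apply/lker0P => u v; rewrite !id_lfunE. Qed.

Fact GL_mul_subproof (f g : GL) : lker (val f \o val g)%VF == 0%VS.
Proof.
apply/lker0P => u v; rewrite !comp_lfunE.
by move/(lker0P (valP f))/(lker0P (valP g)).
Qed.

Fact GL_inv_subproof (f : GL) : lker (val f)^-1%VF == 0%VS.
Proof. by apply/lker0P/(can_inj (lker0_lfunVK (valP f))). Qed.

Definition GL_one : GL := Sub (\1%VF : 'End(V)) GL_one_subproof.
Definition GL_mul (f g : GL) : GL :=
  Sub (val f \o val g)%VF (GL_mul_subproof f g).
Definition GL_inv (f : GL) : GL := Sub (val f)^-1%VF (GL_inv_subproof f).

Let GL_mulA : associative GL_mul.
Proof. by move=> f g h; apply: val_inj; rewrite /= comp_lfunA. Qed.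
Let GL_mul1 : left_id GL_one GL_mul.
Proof. by move=> f; apply: val_inj; rewrite /= comp_lfun1l. Qed.
Let GL_mulr1 : right_id GL_one GL_mul.
Proof. by move=> f; apply: val_inj; rewrite /= comp_lfun1r. Qed.
Let GL_mulV : left_inverse GL_one GL_inv GL_mul.
Proof. by move=> f; apply: val_inj; rewrite /= lker0_compVf ?(valP f). Qed.
Let GL_mulrV : right_inverse GL_one GL_inv GL_mul.
Proof. by move=> f; apply: val_inj; rewrite /= lker0_compfV ?(valP f). Qed.

HB.instance Definition _ := isGroup.Build GL
  GL_mulA GL_mul1 GL_mulr1 GL_mulV GL_mulrV.

Lemma GL_funM (f g : GL) v : GL_fun (f * g) v = GL_fun f (GL_fun g v).
Proof. by rewrite /GL_fun /= comp_lfunE. Qed.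

Lemma GL_fun1 v : GL_fun 1 v = v.
Proof. by rewrite /GL_fun /= id_lfunE. Qed.

Lemma GL_funP (f g : GL) : GL_fun f =1 GL_fun g -> f = g.
Proof. by move=> fg; apply: val_inj; apply/lfunP. Qed.

End GeneralLinear.

Section Tits.
Variables (R : realType) (S : finType) (M : coxeterMatrix S).
Local Open Scope ring_scope.

Definition root_space := {ffun S -> R^o}.
HB.instance Definition _ := Vector.on root_space.

Definition alpha (s : S) : root_space := [ffun t => (t == s)%:R].

Definition gram (s t : S) : R :=
  if M s t is Some k then - 2 * cos (pi / k%:R) else - 2.

Definition tits_form (u v : root_space) : R :=
  \sum_s \sum_t u s * v t * gram s t.

Definition reflection (s : S) (v : root_space) : root_space :=
  v - tits_form v (alpha s) *: alpha s.

Lemma tits_form_linear s a u v :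
  tits_form (a *: u + v) (alpha s) =
  a * tits_form u (alpha s) + tits_form v (alpha s).
Proof.
rewrite /tits_form mulr_sumr -big_split; apply: eq_bigr => x _ /=.
rewrite mulr_sumr -big_split; apply: eq_bigr => y _ /=.
by rewrite !ffunE /GRing.scale /=; ring.
Qed.

Lemma tits_form_alpha s t : tits_form (alpha s) (alpha t) = gram s t.
Proof.
rewrite /tits_form (bigD1 s) //= (bigD1 t) //= !ffunE !eqxx !mul1r.
rewrite big1 ?addr0; last first.
  by move=> y /negPf yt; rewrite !ffunE yt mulr0 mul0r.
rewrite big1 ?addr0 // => x /negPf xs; apply: big1 => y _.
by rewrite !ffunE xs !mul0r.
Qed.

Lemma gram_diag s : gram s s = 2.
Proof. by rewrite /gram cox_diag divr1 cospi; ring. Qed.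

Lemma gram_sym s t : gram s t = gram t s.
Proof. by rewrite /gram cox_sym. Qed.

Fact reflection_linear s : linear (reflection s).
Proof.
move=> a u v; rewrite /reflection tits_form_linear scalerBr scalerDl scalerA.
by rewrite opprD addrACA.
Qed.

HB.instance Definition _ s := GRing.isLinear.Build R root_space root_space _
  (reflection s) (reflection_linear s).

Lemma tits_formB s t a v :
  tits_form (v - a *: alpha t) (alpha s) =
  tits_form v (alpha s) - a * gram t s.
Proof.
by rewrite addrC -scaleNr tits_form_linear tits_form_alpha mulNr addrC.
Qed.

Lemma reflectionK s : involutive (reflection s).
Proof.
move=> v; rewrite /reflection tits_formB gram_diag.
by apply/ffunP => x; rewrite !ffunE /GRing.scale /=; ring.
Qed.

Fact reflection_GL s : lker (linfun (reflection s)) == 0%VS.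
Proof. by apply/lker0P => u v; rewrite !lfunE; apply: inv_inj; exact: reflectionK. Qed.

Definition reflection_gl (s : S) : GL root_space :=
  Sub (linfun (reflection s)) (reflection_GL s).

Lemma reflection_glE s v : GL_fun (reflection_gl s) v = reflection s v.
Proof. by rewrite /GL_fun /= lfunE. Qed.

Lemma reflection_gl_sq s : (reflection_gl s * reflection_gl s = 1)%g.
Proof.
apply: GL_funP => v.
by rewrite GL_funM !reflection_glE reflectionK GL_fun1.
Qed.

Lemma prodR_reflection_gl s t (th : R) n v : gram s t = - 2 * cos th ->
  let p := tits_form v (alpha t) in
  let q := tits_form v (alpha s) in
  let a := (uphalf n)%:R * th in
  let b := (n./2)%:R * th in
  sin th ^+ 2 *: GL_fun (prodR (reflection_gl s) (reflection_gl t) n) v =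
  sin th ^+ 2 *: v
  - (sin a ^+ 2 * p + sin (a - th) * sin a * q) *: alpha t
  - (sin b * sin (b + th) * p + sin b ^+ 2 * q) *: alpha s.
Proof.
elim: n s t v => [|n IH] s t v gst p q a b.
  rewrite /a /b /= !mul0r sin0 GL_fun1.
  by apply/ffunP => x; rewrite !ffunE /GRing.scale /=; ring.
rewrite [prodR _ _ _]/(prodR _ _ n * _)%g GL_funM reflection_glE.
rewrite IH ?(gram_sym t s) // /reflection !tits_formB gram_diag -/p -/q.
rewrite (gram_sym t s) gst.
have aE : a = (n./2)%:R * th + th.
  by rewrite /a uphalfE /= -addn1 natrD mulrDl mul1r.
have -> : b = (uphalf n)%:R * th by [].
rewrite aE; move: ((uphalf n)%:R * th) ((n./2)%:R * th) => {aE}b {}a.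
have bK : sin (b + th) = 2 * cos th * sin b - sin (b - th).
  by rewrite sinD sinB; ring.
have aK : sin (a + th) ^+ 2 =
    sin th ^+ 2 + 2 * cos th * (sin a * sin (a + th)) - sin a ^+ 2.
  have ct : cos th ^+ 2 = 1 - sin th ^+ 2 by rewrite -(cos2Dsin2 th) addrK.
  have ca : cos a ^+ 2 = 1 - sin a ^+ 2 by rewrite -(cos2Dsin2 a) addrK.
  by rewrite sinD; ring: ct ca.
rewrite addrK bK aK.
by apply/ffunP => x; rewrite !ffunE /GRing.scale /=; ring.
Qed.

Lemma reflection_gl_braid s t k : s != t -> M s t = Some k ->
  prodR (reflection_gl t) (reflection_gl s) k =
  prodR (reflection_gl s) (reflection_gl t) k.
Proof.
move=> st Mst; have k2 := cox_ge2 st Mst.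
pose th : R := pi / k%:R.
have k0 : 0 < k%:R :> R by rewrite ltr0n (leq_trans _ k2).
have gst : gram s t = - 2 * cos th by rewrite /gram Mst.
have sth : sin th ^+ 2 != 0.
  rewrite expf_neq0 // gt_eqF // sin_gt0_pi // divr_gt0 ?pi_gt0 //=.
  by rewrite ltr_pdivrMr // ltr_pMr ?pi_gt0 // ltr1n.
have split_k : (k./2)%:R * th = pi - (uphalf k)%:R * th.
  apply/eqP; rewrite eq_sym subr_eq -mulrDl -natrD addnC uphalf_half.
  by rewrite -addnA addnn odd_double_half /th mulrC divfK ?lt0r_neq0.
apply: GL_funP => v; apply: (scalerI sth); rewrite !(@prodR_reflection_gl _ _ th) ?(gram_sym t) //.
rewrite split_k.
have -> : pi - (uphalf k)%:R * th + th = pi - ((uphalf k)%:R * th - th).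
  by rewrite opprB addrA addrAC.
have sinpiB x : sin (pi - x) = sin x :> R by rewrite sinB sinpi cospi; ring.
rewrite !sinpiB.
by apply/ffunP => x; rewrite !ffunE /GRing.scale /=; ring.
Qed.

Lemma tits_rel u v : coxeter_rel M u v ->
  free_lift reflection_gl u = free_lift reflection_gl v.
Proof.
case=> {u v} [s|s t k st Mst].
  rewrite expgS expg1 free_liftM free_lift1 free_lift_gen.
  exact: reflection_gl_sq.
rewrite !(gmulf_prodR (free_lift reflection_gl)) /= !free_lift_gen.
exact: reflection_gl_braid.
Qed.

Definition tits : coxeter_group M -> GL root_space := pres_lift reflection_gl.

Lemma titsM : {morph tits : x y / (x * y)%g}.
Proof. exact: pres_liftM tits_rel. Qed.

HB.instance Definition _ :=
  isMultiplicative.Build (coxeter_group M) (GL root_space) tits titsM.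

Lemma tits_gen s v : GL_fun (tits (coxeter_gen M s)) v = reflection s v.
Proof. by rewrite /tits (pres_lift_gen tits_rel) reflection_glE. Qed.

Definition root_system : set root_space :=
  [set v | exists s w, v = GL_fun (tits w) (alpha s)].

End Tits.

Arguments root_system R {S} M.

(* G is isomorphic to the free abelian group [{freeg I / int}] (finitely
   supported functions from I to the integers), i.e. has a basis indexed
   by I. *)
Definition free_abelian_of_rank (G : groupType) (I : choiceType) : Prop :=
  exists f : G -> {freeg I / int},
    bijective f /\ {morph f : x y / (x * y)%g >-> (x + y)%R}.

(* Main.v *)
(** The Coxeter group W acts on PVA through the section tau : W -> VA, and PVA
    is generated by the conjugates of the sigma_s tau_s by elements w of W. Such
    a conjugate depends only on the root w alpha_s: if w alpha_s = w' alpha_s',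
    then induction on the length of w, splitting off a maximal alternating
    suffix in two generators, reduces the coincidence to the rank-two ones
    Prod_R(s, t, m - 1) alpha_s = alpha_r, which are the mixed relations of VA.
    This uses that a root w alpha_s is nonnegative as soon as
    len (w s) >= len w, which the same decomposition proves.
    Hence there is a map from Z[Phi] to the abelianization of PVA. Its inverse
    comes from the homomorphism VA -> Z[Phi] x| W with
    sigma_s |-> (alpha_s, s) and tau_s |-> (0, s). It respects the braid
    relations for the sigma_s because both sides produce the same rank-two
    positive roots, in opposite orders. *)
From HB Require Import structures.
Require Import Defs.
From mathcomp Require Import all_boot all_order all_algebra.
From mathcomp Require Import boolp classical_sets reals trigo.
From mathcomp Require Import freeg ring zify.

Set Implicit Arguments.
Unset Strict Implicit.
Unset Printing Implicit Defensive.

Import Order.TTheory GRing.Theory Num.Theory.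

Local Open Scope group_scope.

(** * Morphisms of groups and induction on presented groups *)

Section Multiplicative.
Variables (G H : groupType) (f : {multiplicative G -> H}).

Lemma multiplicative1 : f 1 = 1.
Proof. by apply: (@mulgI _ (f 1)); rewrite -gmulfM !mulg1. Qed.

Lemma multiplicativeV x : f x^-1 = (f x)^-1.
Proof. by apply/esym/mulg1_eq; rewrite -gmulfM mulgV multiplicative1. Qed.

End Multiplicative.

Section PresentationInduction.
Variables (X : choiceType) (Rel : free_group X -> free_group X -> Prop).
Local Notation G := (presented Rel).

Lemma pres_ind (P : G -> Prop) : P 1 -> (forall x y, P x -> P y -> P (x * y)) ->
  (forall x, P x -> P x^-1) -> (forall x, P (pres_gen Rel x)) -> forall x, P x.
Proof.
move=> P1 PM PV Pg; elim/quot_ind; elim/free_of_word_ind.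
elim=> [|[x b] u IH] //.
rewrite -cat1s free_of_word_cat quotM; apply: (PM) IH; case: b; last exact: Pg.
have -> : free_of_word [:: (x, true)] = (free_gen x)^-1.
  by apply/esym/mulg1_eq; rewrite -free_of_word_cat; apply/free_of_word_eqP;
    exact: (word_equiv_cancel [::] [::] (x, false)).
by rewrite [quot _ _](multiplicativeV (pres_proj Rel)); exact/PV/Pg.
Qed.

End PresentationInduction.

Lemma coxeter_ind (S : finType) (M : coxeterMatrix S)
    (P : coxeter_group M -> Prop) :
  P 1 -> (forall x y, P x -> P y -> P (x * y)) -> (forall x, P x -> P x^-1) ->
  (forall s, P (coxeter_gen M s)) -> forall x, P x.
Proof. exact: pres_ind. Qed.

Lemma virtual_artin_ind (S : finType) (M : coxeterMatrix S)
    (P : virtual_artin M -> Prop) :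
  P 1 -> (forall x y, P x -> P y -> P (x * y)) -> (forall x, P x -> P x^-1) ->
  (forall s, P (pres_gen (va_rel M) s)) -> forall x, P x.
Proof. exact: pres_ind. Qed.

(** * Word length in W and dihedral suffixes *)

Section CoxeterLength.
Variables (S : finType) (M : coxeterMatrix S).
Local Notation W := (coxeter_group M).
Local Notation gen := (coxeter_gen M).

Lemma coxeter_genK s : gen s * gen s = 1.
Proof. by have := coxeter_gen_sq M s; rewrite expgS expg1. Qed.

Lemma coxeter_genV s : (gen s)^-1 = gen s.
Proof. exact/mulg1_eq/coxeter_genK. Qed.

Lemma coxeter_wordP (w : W) : exists l : seq S, w = \prod_(s <- l) gen s.
Proof.
elim/coxeter_ind: w => [|x y [k ->] [l ->]|x [l ->]|s].
- by exists [::]; rewrite big_nil.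
- by exists (k ++ l); rewrite big_cat.
- exists (rev l); rewrite -[in LHS](revK l) -prodgV; apply: eq_bigr => s _.
  by rewrite [LHS]coxeter_genV.
- by exists [:: s]; rewrite big_seq1.
Qed.

Let word_of_size (w : W) n :=
  `[< exists2 l : seq S, size l = n & w = \prod_(s <- l) gen s >].

Fact len_subproof w : exists n, word_of_size w n.
Proof.
by have [l wE] := coxeter_wordP w; exists (size l); apply/asboolP; exists l.
Qed.

Definition len (w : W) : nat := ex_minn (len_subproof w).

Lemma len_word w : exists2 l : seq S, size l = len w & w = \prod_(s <- l) gen s.
Proof. by rewrite /len; case: ex_minnP => n /asboolP. Qed.

Lemma len_prod (l : seq S) : (len (\prod_(s <- l) gen s)%g <= size l)%N.
Proof.
by rewrite /len; case: ex_minnP => n _; apply; apply/asboolP; exists l.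
Qed.

Lemma len_mul u v : (len (u * v)%g <= len u + len v)%N.
Proof.
have [k <- ->] := len_word u; have [l <- ->] := len_word v.
by rewrite -big_cat -size_cat; exact: len_prod.
Qed.

Lemma len_mul_le u v i j :
  (len u <= i)%N -> (len v <= j)%N -> (len (u * v)%g <= i + j)%N.
Proof. by move=> ui vj; apply: leq_trans (len_mul u v) (leq_add ui vj). Qed.

Lemma len_gen s : (len (gen s) <= 1)%N.
Proof. by have := len_prod [:: s]; rewrite big_seq1. Qed.

Lemma len_prodR s t k : (len (prodR (gen s) (gen t) k) <= k)%N.
Proof.
elim: k s t => [|k IH] s t /=; first by have := len_prod [::]; rewrite big_nil.
apply: leq_trans (len_mul _ _) _; rewrite -addn1.
exact: leq_add (IH _ _) (len_gen _).
Qed.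

Lemma descent_exists w : w != 1 -> exists t, (len (w * gen t)%g < len w)%N.
Proof.
have [l] := len_word w; case/lastP: l => [|l t].
  by move=> _ ->; rewrite big_nil eqxx.
rewrite size_rcons => <- -> _; exists t.
by rewrite -cats1 big_cat big_seq1 -mulgA coxeter_genK mulg1 ltnS len_prod.
Qed.

Lemma prodR_add (G : groupType) (x y : G) n m : prodR x y (n + m) =
  (if odd m then prodR y x n else prodR x y n) * prodR x y m.
Proof.
elim: m x y => [|m IH] x y; first by rewrite addn0 mulg1.
by rewrite addnS /= IH -mulgA; case: (odd m).
Qed.

Definition below_order (s t : S) (k : nat) :=
  if M s t is Some m then (k < m)%N else true.

(* [v] is the minimal representative of the coset of w modulo <s, t>, obtained
   by taking k maximal; if k reached m, the braid relation would let w end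
   in s. *)
Lemma dihedral_decomposition w s : (len w <= len (w * gen s)%g)%N -> w != 1 ->
  exists v t k, [/\ s != t, w = v * prodR (gen s) (gen t) k.+1,
    (len v < len w)%N, below_order s t k.+1 &
    (len v <= len (v * gen s)%g)%N /\ (len v <= len (v * gen t)%g)%N].
Proof.
move=> ws /descent_exists[t wt].
have st : s != t by apply: contraTneq wt => <-; rewrite -leqNgt.
pose P k := `[< exists2 v, w = v * prodR (gen s) (gen t) k
                         & (len v + k <= len w)%N >].
have P1 : P 1%N.
  apply/asboolP; exists (w * gen t); last by rewrite addn1.
  by rewrite /= mul1g -mulgA coxeter_genK mulg1.
have Pub k : P k -> (k <= len w)%N.
  by move=> /asboolP[v _]; apply: leq_trans; exact: leq_addl.
case: (ex_maxnP (ex_intro P 1%N P1) Pub) => -[|k] /asboolP[v wE vk] kmax.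
  by have := kmax _ P1.
exists v, t, k; split => //.
- lia.
- rewrite /below_order; case Mst : (M s t) => [m|//]; rewrite ltnNge.
  apply/negP => mk; move: ws; rewrite leqNgt => /negP; apply.
  rewrite {1}wE -(subnK mk) prodR_add; set x := (if _ then _ else _).
  have xk : (len x <= k.+1 - m)%N.
    by rewrite /x; case: ifP => _; exact: len_prodR.
  have m0 : (0 < m)%N by apply: leq_trans (cox_ge2 st Mst).
  rewrite -(coxeter_gen_braid st Mst) -[m in prodR _ _ m](prednK m0) /=.
  rewrite -!mulgA coxeter_genK mulg1.
  have vxp := len_mul_le (leqnn (len v)) (len_mul_le xk (len_prodR s t m.-1)).
  by apply: leq_ltn_trans vxp _; lia.
(* [a] is the leftmost letter of the suffix. If it shortened v, then w would be shorter than
   [len w]; if the other letter [b] did, it could be split off v and prefixed to the suffix, against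
   its maximal length. *)
- pose a := if odd k then s else t; pose b := if odd k then t else s.
  suff [va vb] : (len v <= len (v * gen a)%g)%N /\
      (len v <= len (v * gen b)%g)%N.
    by move: va vb; rewrite /a /b; case: (odd k).
  split; rewrite leqNgt; apply/negP => lt_v.
    have : w = v * gen a * prodR (gen s) (gen t) k.
      rewrite wE prodRSl /a -mulgA; congr (_ * (_ * _)).
      by case: (odd k).
    have := len_mul_le (leqnn (len (v * gen a)%g)) (len_prodR s t k).
    by move=> + wE'; rewrite -wE'; lia.
  have /kmax : P k.+2; last by rewrite ltnn.
  apply/asboolP; exists (v * gen b); last by lia.
  rewrite wE [prodR _ _ k.+2]prodRSl /b -mulgA; congr (_ * _).
  rewrite mulgA [X in X * _](_ : _ = 1) ?mul1g //=.
  by case: (odd k); exact: coxeter_genK.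
Qed.

End CoxeterLength.

(** * Coordinates of rank-two roots *)

Section DihedralCoefficients.
Variable R : realType.
Local Open Scope ring_scope.

(* [dihedral_coef c n] is sin (n theta) / sin theta when c = 2 cos theta. *)
Fixpoint dihedral_coef (c : R) (n : nat) : R :=
  if n is n'.+1 then
    if n' is n''.+1 then c * dihedral_coef c n' - dihedral_coef c n'' else 1
  else 0.

Lemma dihedral_coefSS c n :
  dihedral_coef c n.+2 = c * dihedral_coef c n.+1 - dihedral_coef c n.
Proof. by []. Qed.

Lemma nat_pair_ind (P : nat -> Prop) :
  P 0%N -> P 1%N -> (forall n, P n -> P n.+1 -> P n.+2) -> forall n, P n.
Proof.
move=> P0 P1 PS n; suff [] : P n /\ P n.+1 by [].
by elim: n => // n [? ?]; split=> //; exact: PS.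
Qed.

Lemma dihedral_coef_sin (th : R) n :
  dihedral_coef (2 * cos th) n * sin th = sin (n%:R * th).
Proof.
elim/nat_pair_ind: n => [||n IH IH1]; rewrite ?mul0r ?sin0 ?mul1r //.
rewrite dihedral_coefSS mulrBl -(mulrA (2 * cos th)) IH1 IH.
have -> : n.+2%:R * th = n.+1%:R * th + th by rewrite -addn1 natrD mulrDl mul1r.
have -> : n%:R * th = n.+1%:R * th - th.
  by rewrite -addn1 natrD mulrDl mul1r addrK.
by rewrite sinB sinD; ring.
Qed.

(** The degenerate angle 0, which serves an infinite entry of M, where [gram] is -2. *)
Lemma dihedral_coef2 n : dihedral_coef 2 n = n%:R.
Proof.
elim/nat_pair_ind: n => [||n IH IH1] //.
by rewrite dihedral_coefSS IH1 IH -[n.+2%:R]natr1 -natr1; ring.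
Qed.

Variables (S : finType) (M : coxeterMatrix S).
Variables (s t : S).
Hypothesis st : s != t.
Local Notation coef := (dihedral_coef (- gram R M s t)).

Section Finite.
Variable m : nat.
Hypothesis Mst : M s t = Some m.
Let th : R := pi / m%:R.

Let m_gt0 : 0 < m%:R :> R.
Proof. by rewrite ltr0n (leq_trans _ (cox_ge2 st Mst)). Qed.

Let sin_th : 0 < sin th.
Proof.
rewrite sin_gt0_pi // divr_gt0 ?pi_gt0 //=.
by rewrite ltr_pdivrMr // ltr_pMr ?pi_gt0 // ltr1n (cox_ge2 st Mst).
Qed.

Let coef_sin n : coef n = sin (n%:R * th) / sin th.
Proof.
rewrite -dihedral_coef_sin mulfK ?gt_eqF //; congr (dihedral_coef _ _).
by rewrite /gram Mst -/th; ring.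
Qed.

(** Since m theta = pi, this is sin (pi - x) = sin x. It later reverses the list of rank-two roots
    in the braid relation for sigma. *)
Lemma dihedral_coef_sym n : (n <= m)%N -> coef (m - n) = coef n.
Proof.
move=> nm; rewrite !coef_sin natrB // mulrBl [m%:R * th]mulrC divfK ?gt_eqF //.
by rewrite sinB sinpi cospi; congr (_ / _); ring.
Qed.

Lemma dihedral_coef_gt0_finite n : (0 < n < m)%N -> 0 < coef n.
Proof.
move=> /andP[n0 nm]; rewrite coef_sin divr_gt0 // sin_gt0_pi //.
rewrite mulr_gt0 ?ltr0n // ?divr_gt0 ?pi_gt0 //=.
by rewrite mulrCA gtr_pMr ?pi_gt0 // ltr_pdivrMr // mul1r ltr_nat.
Qed.

Lemma dihedral_coef_pred : coef m.-1 = 1.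
Proof.
by rewrite -subn1 dihedral_coef_sym // (leq_trans _ (cox_ge2 st Mst)).
Qed.

Lemma dihedral_coef_order : coef m = 0.
Proof. by rewrite -[m]subn0 dihedral_coef_sym. Qed.

End Finite.

Lemma dihedral_coef_gt0 n : (0 < n)%N -> below_order M s t n -> 0 < coef n.
Proof.
rewrite /below_order; case Mst : (M s t) => [m|] n0 nm.
  by rewrite (dihedral_coef_gt0_finite Mst) // n0.
by rewrite /gram Mst opprK dihedral_coef2 ltr0n.
Qed.

(** One step beyond the bound, positivity can fail only at m itself, and then n = m - 1 is the
    length of the alternating word in a mixed relation. *)
Lemma dihedral_coefS_gt0 n : below_order M s t n ->
  0 < coef n.+1 \/ exists2 m, M s t = Some m & n.+1 = m.
Proof.
move=> nm; case Mst : (M s t) => [m|].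
  move: nm; rewrite /below_order Mst leq_eqVlt => /orP[/eqP <-|nm].
    by right; exists n.+1.
  by left; rewrite (dihedral_coef_gt0_finite Mst).
by left; rewrite dihedral_coef_gt0 // /below_order Mst.
Qed.

End DihedralCoefficients.

(** * Signs of roots and coincidences between them *)

Section RootSystem.
Variables (R : realType) (S : finType) (M : coxeterMatrix S).
Local Notation W := (coxeter_group M).
Local Notation gen := (coxeter_gen M).
Local Notation act w v := (GL_fun (tits R (w : coxeter_group M)) v).
Local Notation alpha := (alpha R).
Local Notation coef s t := (dihedral_coef (- gram R M s t)%R).

Lemma actM w w' v : act (w * w') v = act w (act w' v).
Proof. by rewrite titsM GL_funM. Qed.

Lemma act1 v : act 1 v = v.
Proof. by rewrite (multiplicative1 (tits R (M := M))) GL_fun1. Qed.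

Lemma actK (w : W) : cancel (GL_fun (tits R w)) (GL_fun (tits R w^-1)).
Proof. by move=> v; rewrite -actM mulVg act1. Qed.

Local Open Scope ring_scope.

Lemma act_gen s t : act (gen s) (alpha t) = alpha t - gram R M t s *: alpha s.
Proof. by rewrite tits_gen /reflection tits_form_alpha. Qed.

Lemma act_gen_self s : act (gen s) (alpha s) = - alpha s.
Proof.
rewrite act_gen gram_diag; apply/ffunP => x.
by rewrite !ffunE /GRing.scale /=; ring.
Qed.

(** Each new letter on the left reflects the previous vector, and the recurrence of [dihedral_coef]
    records the change of coordinates. *)
Lemma act_prodR s t k : act (prodR (gen s) (gen t) k) (alpha s) =
  coef s t k.+1 *: alpha (if odd k then t else s) +
  coef s t k *: alpha (if odd k then s else t).
Proof.
elim: k => [|k IH]; first by rewrite act1 /= scale1r scale0r addr0.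
have -> : prodR (gen s) (gen t) k.+1 =
    (gen (if odd k then s else t) * prodR (gen s) (gen t) k)%g.
  by rewrite prodRSl; case: (odd k).
rewrite actM IH linearD !linearZ /= act_gen_self act_gen.
have -> : gram R M (if odd k then t else s) (if odd k then s else t) =
    gram R M s t by case: (odd k); rewrite // gram_sym.
by case: (odd k); apply/ffunP => x; rewrite !ffunE /GRing.scale /=; ring.
Qed.

Definition nonneg (v : root_space R S) := forall x, 0 <= v x.

Lemma nonneg_alpha s : nonneg (alpha s).
Proof. by move=> x; rewrite ffunE. Qed.

Lemma alpha_neq0 (s : S) : alpha s != 0.
Proof. by apply/eqP => /ffunP/(_ s)/eqP; rewrite !ffunE eqxx oner_eq0. Qed.

Lemma nonnegD c d u v : 0 <= c -> 0 <= d -> nonneg u -> nonneg v ->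
  nonneg (c *: u + d *: v).
Proof. by move=> c0 d0 u0 v0 x; rewrite !ffunE addr_ge0 // mulr_ge0. Qed.

(** Strong induction on length. In w = v p with p the maximal alternating suffix, neither s nor t
    shortens v, so v sends both simple roots to nonnegative vectors, and p alpha_s is a nonnegative
    combination of the two roots. *)
Lemma nonneg_act w s :
  (len w <= len (w * gen s)%g)%N -> nonneg (act w (alpha s)).
Proof.
have [n] := ubnP (len w); elim: n w s => // n IH w s wn ws.
have [->|w1] := eqVneq w 1%g; first by rewrite act1; exact: nonneg_alpha.
have [v [t [k [st wE vw kst [vs vt]]]]] := dihedral_decomposition ws w1.
have vn : (len v < n)%N by exact: leq_trans vw wn.
move: {vs vt}(IH _ _ vn vs) (IH _ _ vn vt) => vs vt.
rewrite wE actM act_prodR linearD !linearZ /=.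
have k0 : 0 <= coef s t k.+1 by rewrite ltW // (dihedral_coef_gt0 R st).
have k1 : 0 <= coef s t k.+2.
  have [/ltW //|[m Mst ->]] := dihedral_coefS_gt0 R st kst.
  by rewrite (dihedral_coef_order R st Mst).
by case: (odd k); apply: nonnegD.
Qed.

(** If s shortened w, [nonneg_act] at w s would make -w alpha_s nonnegative too, hence w alpha_s =
    0, although w acts injectively. *)
Lemma ascent_of_nonneg w s : nonneg (act w (alpha s)) ->
  (len w <= len (w * gen s)%g)%N.
Proof.
move=> w0; rewrite leqNgt; apply/negP => ws.
have := @nonneg_act (w * gen s)%g s; rewrite -mulgA coxeter_genK mulg1.
move=> /(_ (ltnW ws)); rewrite actM act_gen_self linearN /= => wN.
have /eqP : act w (alpha s) = 0.
  apply/ffunP => x; apply/le_anti; rewrite [in X in _ && X]ffunE w0 andbT.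
  by have := wN x; rewrite !ffunE oppr_ge0.
rewrite -[X in _ == X](linear0 (GL_fun (tits R (M := M) w))) (can_eq (actK w)).
by rewrite (negPf (alpha_neq0 s)).
Qed.

(** alpha_s spans an extreme ray of the nonnegative cone, so w alpha_a and w alpha_b would both be
    multiples of it, against the independence of alpha_a and alpha_b. *)
Lemma act_nonneg_combination w a b c d s : a != b -> 0 < c -> 0 < d ->
  nonneg (act w (alpha a)) -> nonneg (act w (alpha b)) ->
  c *: act w (alpha a) + d *: act w (alpha b) <> alpha s.
Proof.
move=> ab c0 d0 wa wb sE.
have supp v e : 0 < e -> nonneg v -> (forall x, e * v x <= alpha s x) ->
    exists f, v = f *: alpha s.
  move=> e0 v0 vs; exists (v s); apply/ffunP => x.
  rewrite !ffunE /GRing.scale /=.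
  have [->|xs] := eqVneq x s; first by rewrite mulr1.
  rewrite mulr0; apply/le_anti; rewrite v0 andbT -(pmulr_rle0 _ e0).
  by have := vs x; rewrite !ffunE (negPf xs).
have [f waE] : exists f, act w (alpha a) = f *: alpha s.
  by apply: supp c0 wa _ => x; rewrite -sE !ffunE lerDl mulr_ge0 // ltW.
have [g wbE] : exists g, act w (alpha b) = g *: alpha s.
  by apply: supp d0 wb _ => x; rewrite -sE !ffunE lerDr mulr_ge0 // ltW.
(* w maps this vector to (g f - f g) alpha_s = 0. Its coordinate at b then gives f = 0, hence w
   alpha_a = 0. *)
have : act w (g *: alpha a - f *: alpha b) = act w 0.
  rewrite linear0 linearB !linearZ /= waE wbE scalerN !scalerA.
  by rewrite (mulrC g) subrr.
move=> /(can_inj (actK w))/ffunP/(_ b).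
rewrite !ffunE eqxx eq_sym (negPf ab) /GRing.scale /= mulr0 mulr1 sub0r.
move/eqP; rewrite oppr_eq0 => /eqP f0.
move: waE; rewrite f0 scale0r -(linear0 (GL_fun (tits R w))).
by move/(can_inj (actK w))/eqP; rewrite (negPf (alpha_neq0 a)).
Qed.

Lemma act_alpha_braid s t m : s != t -> M s t = Some m ->
  act (prodR (gen s) (gen t) m.-1) (alpha s) = alpha (if odd m then t else s).
Proof.
move=> st Mst; rewrite act_prodR (dihedral_coef_pred R st Mst) scale1r.
have m0 : (0 < m)%N by apply: leq_trans (cox_ge2 st Mst).
rewrite prednK // (dihedral_coef_order R st Mst) scale0r add0r.
by rewrite -[in RHS](prednK m0) /=; case: (odd m.-1).
Qed.

(* The stabiliser of a simple root, and more generally the coincidences between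
   the roots w alpha_s, are generated by the rank-two ones. *)
Lemma root_function (T : Type) (F : W -> S -> T) :
  (forall w s t m, s != t -> M s t = Some m ->
     F (w * prodR (gen s) (gen t) m.-1)%g s = F w (if odd m then t else s)) ->
  forall w w' s s', act w (alpha s) = act w' (alpha s') -> F w s = F w' s'.
Proof.
move=> + w w' s s' ww'.
(* Left translation by w' makes the second root simple, at the price of replacing F by F (w' *
   _). *)
suff H (F' : W -> S -> T) :
    (forall w s t m, s != t -> M s t = Some m ->
       F' (w * prodR (gen s) (gen t) m.-1)%g s =
       F' w (if odd m then t else s)) ->
    forall w s s', act w (alpha s) = alpha s' -> F' w s = F' 1%g s'.
  move=> FE; have := H (fun u => F (w' * u)%g) _ (w'^-1 * w)%g s s'.
  rewrite mulVKg mulg1; apply; last by rewrite actM ww' actK.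
  by move=> u x y m xy Mxy; rewrite mulgA FE.
move=> {w w' s s' ww' F} FE w; have [n] := ubnP (len w).
elim: n w => // n IH w wn s s' ws.
have [w1|w1] := eqVneq w 1%g.
  rewrite w1; move: ws; rewrite w1 act1 => /ffunP/(_ s)/eqP.
  rewrite !ffunE eqxx.
  by have [->|_] := eqVneq s s'; rewrite // oner_eq0.
have asc : (len w <= len (w * gen s)%g)%N.
  by apply: ascent_of_nonneg; rewrite ws; exact: nonneg_alpha.
have [v [t [k [st wE vw kst [vs vt]]]]] := dihedral_decomposition asc w1.
(* If the suffix has length m - 1, the hypothesis on F' removes it and v is shorter. Otherwise both
   coefficients are positive and [act_nonneg_combination] excludes the case. *)
have [k2|[m Mst kE]] := dihedral_coefS_gt0 R st kst; last first.
  move: wE ws; rewrite -[k.+1]/(k.+2.-1) kE => ->.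
  rewrite actM act_alpha_braid // => vs'; rewrite FE //; apply: IH => //.
  exact: leq_trans vw wn.
have k1 : 0 < coef s t k.+1 by rewrite (dihedral_coef_gt0 R st).
move: ws; rewrite wE actM act_prodR linearD !linearZ /= => ws.
exfalso; move: ws; have {vs vt} := (nonneg_act vs, nonneg_act vt).
case: (odd k) => /= -[? ?]; apply: act_nonneg_combination => //.
by rewrite eq_sym.
Qed.

End RootSystem.

(** * Abelianizations and free abelian groups *)

Section AbelianizationZmodule.
Variable G : groupType.

(** A second name for the quotient, which carries the additive structure while [abelianization]
    keeps the multiplicative one. *)
Definition abelianized := abelianization G.
HB.instance Definition _ := Choice.on abelianized.

Local Notation A := (abelianization G).

Lemma abelianization_mulC : commutative (@monoid.mul A).
Proof.
elim/quot_ind => x; elim/quot_ind => y; rewrite -!quotM; apply/quot_eqP.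
apply: sub_generated; exists y, x.
by rewrite invgM commgEl conjgE !mulgA.
Qed.

HB.instance Definition _ := GRing.isZmodule.Build abelianized
  (@monoid.mulgA A) abelianization_mulC (@monoid.mul1g A) (@monoid.mulVg A).

End AbelianizationZmodule.

Section FreegHom.
Variable K : choiceType.
Local Open Scope ring_scope.

(** For bare functions that respect sums, so that composites can be compared on basis elements
    without being declared additive. *)
Lemma freeg_hom_eq (A : zmodType) (f g : {freeg K / int} -> A) :
  {morph f : x y / x + y} -> {morph g : x y / x + y} ->
  (forall x, f << x >> = g << x >>) -> f =1 g.
Proof.
move=> fD gD fg.
have f0 : f 0 = 0 by apply: (@addrI _ (f 0)); rewrite -fD !addr0.
have g0 : g 0 = 0 by apply: (@addrI _ (g 0)); rewrite -gD !addr0.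
have fN x : f (- x) = - f x.
  by apply: (@addrI _ (f x)); rewrite -fD !subrr.
have gN x : g (- x) = - g x.
  by apply: (@addrI _ (g x)); rewrite -gD !subrr.
have fgn n x : f (<< x >> *+ n) = g (<< x >> *+ n).
  by elim: n => [|n IH]; rewrite ?mulr0n ?f0 ?g0 // !mulrS fD gD IH fg.
move=> D; rewrite -[D]freeg_sumE; elim: (dom D) => [|x s IH].
  by rewrite big_nil f0 g0.
rewrite big_cons fD gD IH -[coeff x D]intz -freegU_mulz.
by case: (coeff x D) => n; rewrite ?NegzE ?mulrNz -pmulrn ?fN ?gN fgn.
Qed.

(** [fglift] takes a module as target; [ssrint.zmodule A] is A seen as a module over the
    integers. *)
Definition freeg_extend (A : zmodType) (h : K -> A) : {freeg K / int} -> A :=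
  fglift (M := ssrint.zmodule A) h.

Lemma freeg_extendD (A : zmodType) (h : K -> A) :
  {morph freeg_extend h : x y / x + y}.
Proof.
have hB := lift_is_additive (M := ssrint.zmodule A) h.
have h0 : freeg_extend h 0 = 0 by rewrite -[0](subrr 0) [LHS]hB subrr.
move=> x y; rewrite -[y in LHS]opprK -[- y]sub0r.
by rewrite [LHS]hB [X in _ - X]hB -/(freeg_extend h 0) h0 sub0r opprK.
Qed.

Lemma freeg_extendU (A : zmodType) (h : K -> A) x :
  freeg_extend h << x >> = h x.
Proof. by rewrite /freeg_extend liftU scale1r. Qed.

End FreegHom.

(** * The semidirect product of Z[Phi] and W, and the morphism from VA *)

Section RootWreathProduct.
Variables (R : realType) (S : finType) (M : coxeterMatrix S).
Local Notation W := (coxeter_group M).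
Local Notation gen := (coxeter_gen M).
Local Notation act w v := (GL_fun (tits R (w : coxeter_group M)) v).
Local Notation alpha := (alpha R).
Local Notation Phi := (set_type (root_system R M)).
Local Notation Z := {freeg Phi / int}.
Local Notation coef s t := (dihedral_coef (- gram R M s t)%R).

Lemma root_system_act (w : W) v :
  root_system R M v -> root_system R M (act w v).
Proof. by move=> [s [u ->]]; exists s, (w * u); rewrite actM. Qed.

Definition root_act (w : W) (b : Phi) : Phi :=
  SigSub (mem_set (root_system_act w (set_mem (valP b)))).

Lemma root_act1 b : root_act 1 b = b.
Proof. by apply: val_inj; rewrite /= act1. Qed.

Lemma root_actM w w' b : root_act (w * w') b = root_act w (root_act w' b).
Proof. by apply: val_inj; rewrite /= actM. Qed.

Definition freeg_act (w : W) : Z -> Z :=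
  freeg_extend (fun b => << root_act w b >>).

Lemma freeg_actD w : {morph freeg_act w : x y / (x + y)%R}.
Proof. exact: freeg_extendD. Qed.

Lemma freeg_actU w b : freeg_act w << b >> = << root_act w b >>.
Proof. exact: freeg_extendU. Qed.

Lemma freeg_act0 w : freeg_act w 0%R = 0%R.
Proof. by apply: (@addrI _ (freeg_act w 0%R)); rewrite -freeg_actD !addr0. Qed.

Lemma freeg_act1 : freeg_act 1 =1 id.
Proof.
apply: freeg_hom_eq => [||b] //; first exact: freeg_actD.
by rewrite freeg_actU root_act1.
Qed.

Lemma freeg_actM w w' x : freeg_act (w * w') x = freeg_act w (freeg_act w' x).
Proof.
move: x; apply: freeg_hom_eq => [|x y|b]; first exact: freeg_actD.
  by rewrite !freeg_actD.
by rewrite !freeg_actU root_actM.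
Qed.

Definition wreath := (Z * W)%type.
HB.instance Definition _ := Choice.on wreath.

Definition wreath_mul (x y : wreath) : wreath :=
  ((x.1 + freeg_act x.2 y.1)%R, x.2 * y.2).
Definition wreath_one : wreath := (0%R, 1).
Definition wreath_inv (x : wreath) : wreath :=
  ((- freeg_act (x.2)^-1%g x.1)%R, (x.2)^-1).

Let wreath_mulA : associative wreath_mul.
Proof.
by move=> x y z; rewrite /wreath_mul /= freeg_actD freeg_actM addrA mulgA.
Qed.
Let wreath_mul1 : left_id wreath_one wreath_mul.
Proof. by case=> a w; rewrite /wreath_mul /= freeg_act1 add0r mul1g. Qed.
Let wreath_mulr1 : right_id wreath_one wreath_mul.
Proof. by case=> a w; rewrite /wreath_mul /= freeg_act0 addr0 mulg1. Qed.
Let wreath_mulV : left_inverse wreath_one wreath_inv wreath_mul.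
Proof. by case=> a w; rewrite /wreath_mul /= addNr mulVg. Qed.
Let wreath_mulrV : right_inverse wreath_one wreath_inv wreath_mul.
Proof.
case=> a w; rewrite /wreath_mul /= mulgV.
congr (_, _); have := freeg_actD w (freeg_act w^-1 a) (- freeg_act w^-1%g a)%R.
by rewrite subrr freeg_act0 -freeg_actM mulgV freeg_act1 => <-.
Qed.

HB.instance Definition _ := isGroup.Build wreath
  wreath_mulA wreath_mul1 wreath_mulr1 wreath_mulV wreath_mulrV.

Lemma wreathM (x y : wreath) :
  x * y = ((x.1 + freeg_act x.2 y.1)%R, x.2 * y.2) :> wreath.
Proof. by []. Qed.

(** The default 0 off the root system lets explicit combinations of simple roots be written without
    a membership proof. *)
Definition root_class (v : root_space R S) : Z :=
  if insub v is Some b then << b >> else 0%R.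

Lemma root_class_val (b : Phi) : root_class (val b) = << b >>.
Proof. by rewrite /root_class valK. Qed.

Lemma freeg_act_class w v : root_system R M v ->
  freeg_act w (root_class v) = root_class (act w v).
Proof.
move=> vPhi; rewrite -[v]/(val (SigSub (mem_set vPhi) : Phi)) root_class_val.
by rewrite freeg_actU -root_class_val.
Qed.

Lemma alpha_root s : root_system R M (alpha s).
Proof. by exists s, 1; rewrite act1. Qed.

Definition wreath_gen (x : S + S) : wreath :=
  match x with
  | inl s => (root_class (alpha s), gen s)
  | inr s => (0%R, gen s)
  end.

Lemma wreath_prodR_tau s t k :
  prodR (wreath_gen (inr s)) (wreath_gen (inr t)) k =
  (0%R, prodR (gen s) (gen t) k).
Proof.
elim: k s t => [|k IH] s t //=.
by rewrite IH wreathM /= freeg_act0 addr0.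
Qed.

(** Each factor contributes its simple root moved by the letters to its left; [act_prodR] gives the
    coordinates. *)
Lemma wreath_prodR_sigma s t k :
  prodR (wreath_gen (inl s)) (wreath_gen (inl t)) k =
  ((\sum_(i < k) root_class
     (coef s t i.+1 *: alpha (if odd k then t else s) +
      coef s t i *: alpha (if odd k then s else t)))%R,
   prodR (gen s) (gen t) k).
Proof.
elim: k s t => [|k IH] s t /=; first by rewrite big_ord0.
rewrite IH wreathM /= freeg_act_class; last exact: alpha_root.
congr (_, _); rewrite act_prodR big_ord_recr /= gram_sym !if_neg.
by congr (_ + _)%R; apply: eq_bigr => i _; case: (odd k).
Qed.

Lemma wreath_rel u v : va_rel M u v ->
  free_lift wreath_gen u = free_lift wreath_gen v.
Proof.
have fs s : free_lift wreath_gen (sigma_word s) = wreath_gen (inl s).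
  by rewrite free_lift_gen.
have ft s : free_lift wreath_gen (tau_word s) = wreath_gen (inr s).
  by rewrite free_lift_gen.
have fprod x y k : free_lift wreath_gen (prodR x y k) =
    prodR (free_lift wreath_gen x) (free_lift wreath_gen y) k.
  exact: (gmulf_prodR (free_lift wreath_gen)).
case=> {u v} [s t k st Mst|s t k st Mst|s|s t k st Mst].
- rewrite !fprod !fs !wreath_prodR_sigma (coxeter_gen_braid st Mst).
  (* Read backwards, one sum has its coefficients at i and i + 1 exchanged by [dihedral_coef_sym],
     which turns it into the other. *)
  congr (_, _); rewrite (gram_sym R M t s) (reindex_inj rev_ord_inj).
  apply: eq_bigr => i _.
  have -> : (rev_ord i).+1 = (k - i)%N by rewrite /= subnSK.
  rewrite [rev_ord i : nat]/= !(dihedral_coef_sym R st Mst) //;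
    last exact: ltnW (ltn_ord i).
  by rewrite addrC; case: (odd k).
- by rewrite !fprod !ft !wreath_prodR_tau (coxeter_gen_braid st Mst).
- rewrite !expgS expg0 mulg1 free_liftM free_lift1 ft wreathM /=.
  by rewrite freeg_act0 addr0 coxeter_genK.
(* Mixed relation: the roots agree by [act_alpha_braid], the W-components by the braid relation. *)
- rewrite !free_liftM !fprod !fs !ft wreath_prodR_tau !wreathM /=.
  rewrite freeg_act0 addr0 add0r freeg_act_class; last exact: alpha_root.
  rewrite (act_alpha_braid R st Mst).
  have : (0 < k)%N by apply: leq_trans (cox_ge2 st Mst).
  case: k Mst => // k Mst _ /=; congr (_, _).
  have := coxeter_gen_braid st Mst; rewrite /= => ->.
  rewrite -[LHS]/(prodR (gen s) (gen t) k.+1) prodRSl.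
  by case: (odd k).
Qed.

Definition to_wreath : virtual_artin M -> wreath := pres_lift wreath_gen.

Lemma to_wreathM : {morph to_wreath : x y / x * y}.
Proof. exact: pres_liftM wreath_rel. Qed.

HB.instance Definition _ :=
  isMultiplicative.Build (virtual_artin M) wreath to_wreath to_wreathM.

Lemma to_wreath_gen x : to_wreath (pres_gen (va_rel M) x) = wreath_gen x.
Proof. exact: pres_lift_gen wreath_rel x. Qed.

(** On PVA the second component is therefore 1, so there the first one is additive. *)
Lemma to_wreath_snd x : (to_wreath x).2 = Defs.piP x.
Proof.
elim/virtual_artin_ind: x => [|x y IHx IHy|x IH|x].
- by rewrite (multiplicative1 to_wreath) (multiplicative1 (@Defs.piP S M)).
- by rewrite piPM -IHx -IHy to_wreathM.
- rewrite (multiplicativeV to_wreath) (multiplicativeV (@Defs.piP S M)).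
  by rewrite /= IH.
- by rewrite to_wreath_gen piP_gen; case: x.
Qed.

End RootWreathProduct.

(** * The section of W and generators of PVA *)

Section PureVirtualArtin.
Variables (S : finType) (M : coxeterMatrix S).
Local Notation W := (coxeter_group M).
Local Notation gen := (coxeter_gen M).
Local Notation VA := (virtual_artin M).
Local Notation PVA := (pure_virtual_artin M).
Local Notation piP := (@Defs.piP S M).

Definition sigma s : VA := pres_gen (va_rel M) (inl s).
Definition tau s : VA := pres_gen (va_rel M) (inr s).

Lemma tau_sq s : tau s * tau s = 1.
Proof.
by have := pres_rel (va_rel_tau_sq M s); rewrite expgS expg1 pres_projM.
Qed.

Lemma tau_braid s t k : s != t -> M s t = Some k ->
  prodR (tau t) (tau s) k = prodR (tau s) (tau t) k.
Proof.
move=> st Mst; have := pres_rel (va_rel_tau st Mst).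
by rewrite !(gmulf_prodR (pres_proj _)).
Qed.

Lemma tau_sigma s t k : s != t -> M s t = Some k ->
  prodR (tau s) (tau t) k.-1 * sigma s =
  sigma (if odd k then t else s) * prodR (tau s) (tau t) k.-1.
Proof.
move=> st Mst; have := pres_rel (va_rel_mixed st Mst).
by rewrite !pres_projM !(gmulf_prodR (pres_proj _)).
Qed.

(** A consequence of the braid relation for tau. Together with [tau_sigma] it shows that the
    alternating word conjugates sigma_s tau_s to sigma_r tau_r with a common index r. *)
Lemma tau_tau s t k : s != t -> M s t = Some k ->
  prodR (tau s) (tau t) k.-1 * tau s =
  tau (if odd k then t else s) * prodR (tau s) (tau t) k.-1.
Proof.
move=> st Mst; have k0 : (0 < k)%N by apply: leq_trans (cox_ge2 st Mst).
have := tau_braid st Mst; rewrite -[k in prodR _ _ k](prednK k0) /= => ->.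
rewrite -[in LHS](prednK k0) prodRSl -[in odd k](prednK k0) /=.
by case: (odd k.-1).
Qed.

Lemma section_rel u v : coxeter_rel M u v -> free_lift tau u = free_lift tau v.
Proof.
case=> {u v} [s|s t k st Mst].
  by rewrite expgS expg1 free_liftM free_lift1 free_lift_gen tau_sq.
by rewrite !(gmulf_prodR (free_lift tau)) /= !free_lift_gen tau_braid.
Qed.

Definition coxeter_section : W -> VA := pres_lift tau.
Local Notation iota := coxeter_section.

Lemma coxeter_sectionM : {morph iota : x y / x * y}.
Proof. exact: pres_liftM section_rel. Qed.

HB.instance Definition _ :=
  isMultiplicative.Build (coxeter_group M) (virtual_artin M) coxeter_section
    coxeter_sectionM.

Lemma coxeter_section_gen s : iota (gen s) = tau s.
Proof. exact: pres_lift_gen section_rel s. Qed.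

Lemma coxeter_section1 : iota 1 = 1. Proof. exact: multiplicative1. Qed.
Lemma coxeter_sectionV w : iota w^-1 = (iota w)^-1.
Proof. exact: multiplicativeV. Qed.
Lemma piP1 : piP 1 = 1. Proof. exact: multiplicative1. Qed.
Lemma piPV x : piP x^-1 = (piP x)^-1. Proof. exact: multiplicativeV. Qed.

Lemma piP_section : cancel iota piP.
Proof.
elim/coxeter_ind => [|x y IHx IHy|x IH|s].
- by rewrite coxeter_section1 piP1.
- by rewrite coxeter_sectionM piPM IHx IHy.
- by rewrite coxeter_sectionV piPV IH.
- by rewrite [iota _]coxeter_section_gen piP_gen.
Qed.

(* The pure part [x * iota (piP x)^-1] of [x], conjugated by [w]; for
   x = sigma_s it represents the generator attached to the root w alpha_s. *)
Definition pure_conj (w : W) (x : VA) : VA :=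
  iota w * x * (iota (piP x))^-1 * (iota w)^-1.

Lemma pure_conj_kernel w x : pure_conj w x \in kernel_pred piP.
Proof.
by apply/eqP; rewrite /= /pure_conj !piPM !piPV !piP_section mulgK mulgV.
Qed.

Definition to_pure w x : PVA := Sub (pure_conj w x) (pure_conj_kernel w x).

(** A crossed-morphism rule: the inserted [iota (piP x)] and its inverse cancel. With [to_pure_tau]
    and [to_pure_val] it makes the elements to_pure w sigma_s generate PVA. *)
Lemma to_pureM w x y : to_pure w (x * y) = to_pure w x * to_pure (w * piP x) y.
Proof.
apply: val_inj; rewrite valM /= /pure_conj piPM !coxeter_sectionM.
by rewrite !invgM !mulgA !mulgVK.
Qed.

Lemma to_pure1 w : to_pure w 1 = 1.
Proof.
apply: val_inj; rewrite val1 /= /pure_conj piP1 coxeter_section1.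
by rewrite invg1 !mulg1 mulgV.
Qed.

Lemma to_pure_tau w s : to_pure w (tau s) = 1.
Proof.
apply: val_inj; rewrite val1 /= /pure_conj piP_gen /= coxeter_section_gen.
by rewrite mulgK mulgV.
Qed.

Lemma to_pure_val (x : PVA) : to_pure 1 (val x) = x.
Proof.
apply: val_inj; rewrite /= /pure_conj; have := valP x; rewrite inE => /eqP ->.
by rewrite coxeter_section1 invg1 !mulg1 mul1g.
Qed.

(** The mixed relation read in PVA; it is the hypothesis of [root_function] for to_pure w
    sigma_s. *)
Lemma to_pure_braid w s t k : s != t -> M s t = Some k ->
  to_pure (w * prodR (gen s) (gen t) k.-1) (sigma s) =
  to_pure w (sigma (if odd k then t else s)).
Proof.
move=> st Mst; apply: val_inj; rewrite /= /pure_conj !piP_gen /=.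
rewrite !coxeter_section_gen coxeter_sectionM (gmulf_prodR coxeter_section).
rewrite /= !coxeter_section_gen; set p := prodR _ _ _.
have -> : sigma s = p^-1 * (sigma (if odd k then t else s) * p).
  by rewrite -tau_sigma // mulKg.
have -> : tau s = p^-1 * (tau (if odd k then t else s) * p).
  by rewrite -tau_tau // mulKg.
by rewrite !invgM invgK !mulgA !mulgK.
Qed.

End PureVirtualArtin.

(** * The two mutually inverse maps *)

Section Abelianization.
Variables (R : realType) (S : finType) (M : coxeterMatrix S).
Local Notation W := (coxeter_group M).
Local Notation act w v := (GL_fun (tits R (w : coxeter_group M)) v).
Local Notation VA := (virtual_artin M).
Local Notation PVA := (pure_virtual_artin M).
Local Notation Phi := (set_type (root_system R M)).
Local Notation Z := {freeg Phi / int}.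
Local Notation Ab := (abelianized PVA).
Local Notation cls := (quot (derived_ns PVA)).

Lemma root_witness (b : Phi) :
  {ws : W * S | val b = act ws.1 (alpha R ws.2)}.
Proof.
apply: cid; have [s [w bE]] := set_mem (valP b); by exists (w, s).
Qed.

Definition root_generator (b : Phi) : Ab :=
  let: (w, s) := sval (root_witness b) in cls (to_pure w (sigma M s)).

(** The chosen witness does not matter: by [root_function] the elements already agree in PVA, before
    abelianization. *)
Lemma root_generatorE (b : Phi) w s : val b = act w (alpha R s) ->
  root_generator b = cls (to_pure w (sigma M s)).
Proof.
rewrite /root_generator; case: root_witness => -[w' s'] /= -> bE.
congr cls.
apply: (root_function (F := fun w s => to_pure w (sigma M s))) bE.
by move=> *; exact: to_pure_braid.
Qed.

Definition from_freeg : Z -> Ab := freeg_extend root_generator.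

Lemma from_freegD : {morph from_freeg : x y / (x + y)%R}.
Proof. exact: freeg_extendD. Qed.

Lemma from_freeg0 : from_freeg 0%R = 0%R.
Proof. by apply: (@addrI _ (from_freeg 0%R)); rewrite -from_freegD !addr0. Qed.

(** Both sides obey the same product rule in x, so generators suffice. Since that rule turns w into
    w * piP x, the induction needs all w at once. *)
Lemma from_freeg_to_wreath (x : VA) (w : W) :
  from_freeg (freeg_act w (to_wreath R x).1) = cls (to_pure w x).
Proof.
elim/virtual_artin_ind: x w => [|x y IHx IHy|x IH|[s|s]] w.
- rewrite to_pure1 (multiplicative1 (@to_wreath R S M)) freeg_act0.
  exact: from_freeg0.
- rewrite to_wreathM to_pureM quotM wreathM /= freeg_actD from_freegD IHx.
  by rewrite -freeg_actM IHy to_wreath_snd.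
(* Expand the trivial product x^-1 * x by the product rule, then cancel the factor of x by the
   induction hypothesis at the translated w. *)
- have : from_freeg (freeg_act w (to_wreath R (x^-1 * x)%g).1) =
      cls (to_pure w (x^-1 * x)).
    rewrite mulVg to_pure1 (multiplicative1 (@to_wreath R S M)) freeg_act0.
    exact: from_freeg0.
  rewrite to_wreathM to_pureM quotM wreathM /= freeg_actD from_freegD.
  rewrite -freeg_actM IH to_wreath_snd.
  exact: (@mulIg Ab).
- rewrite to_wreath_gen /= freeg_act_class; last exact: alpha_root.
  pose b : Phi := SigSub (mem_set (root_system_act w (alpha_root R M s))).
  rewrite -[GL_fun _ _]/(val b) root_class_val [LHS]freeg_extendU.
  exact: root_generatorE.
- by rewrite to_wreath_gen /= freeg_act0 from_freeg0 to_pure_tau.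
Qed.

Definition to_freeg (u : abelianization PVA) : Z :=
  (to_wreath R (val (repr u))).1.

Let phi (x : PVA) : Z := (to_wreath R (val x)).1.

Let phiM x y : phi (x * y) = (phi x + phi y)%R.
Proof.
rewrite /phi valM to_wreathM wreathM /= to_wreath_snd.
by have /eqP -> := valP x; rewrite freeg_act1.
Qed.

Let phi1 : phi 1 = 0%R.
Proof. by apply: (@addrI _ (phi 1)); rewrite -phiM mulg1 addr0. Qed.

Let phiV x : phi x^-1 = (- phi x)%R.
Proof. by apply: (@addrI _ (phi x)); rewrite -phiM mulgV subrr. Qed.

(** [phi] is additive on PVA with an abelian target, so it kills the derived subgroup and is
    constant on the class from which [to_freeg] picks a representative. *)
Lemma to_freeg_quot (x : PVA) : to_freeg (cls x) = (to_wreath R (val x)).1.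
Proof.
rewrite -/(phi x) /to_freeg; set y := repr _; rewrite -/(phi y).
have /quot_eqP/generatedP/(_ [pred z | phi z == 0%R]) : cls y = cls x.
  by rewrite /quot reprK.
rewrite inE phiM phiV addrC subr_eq0 => yx; apply/esym/eqP/yx.
  split=> [|a b]; rewrite !inE ?phi1 // phiM phiV => /eqP-> /eqP->.
  by rewrite subrr.
move=> _ [a [b ->]]; rewrite inE commgEl conjgE !phiM !phiV.
by rewrite [(phi a + _)%R]addrC addKr addNr.
Qed.

Lemma to_wreath_section (w : W) :
  to_wreath R (coxeter_section w) = (0%R, w) :> wreath R M.
Proof.
elim/coxeter_ind: w => [|x y IHx IHy|x IH|s].
- by rewrite coxeter_section1 (multiplicative1 (@to_wreath R S M)).
- by rewrite coxeter_sectionM to_wreathM IHx IHy wreathM /= freeg_act0 addr0.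
- rewrite coxeter_sectionV (multiplicativeV (@to_wreath R S M)) /= IH.
  by apply: mulg1_eq; rewrite wreathM /= freeg_act0 addr0 mulgV.
- by rewrite [coxeter_section _]coxeter_section_gen to_wreath_gen.
Qed.

Lemma to_wreath_pure_conj (w : W) (x : VA) :
  (to_wreath R (pure_conj w x)).1 = freeg_act w (to_wreath R x).1.
Proof.
rewrite /pure_conj -!coxeter_sectionV !to_wreathM !to_wreath_section.
rewrite !wreathM /=.
by rewrite !freeg_act0 !addr0 add0r.
Qed.

Lemma to_freegM : {morph to_freeg : x y / x * y >-> (x + y)%R}.
Proof.
elim/quot_ind => x; elim/quot_ind => y.
by rewrite -quotM !to_freeg_quot; exact: phiM.
Qed.

Lemma to_freegK : cancel to_freeg from_freeg.
Proof.
elim/quot_ind => x; rewrite to_freeg_quot -[X in from_freeg X]freeg_act1.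
by rewrite from_freeg_to_wreath to_pure_val.
Qed.

Lemma from_freegK : cancel from_freeg to_freeg.
Proof.
apply: freeg_hom_eq => [x y||b] //.
  by rewrite from_freegD; exact: to_freegM.
have [s [w bE]] := set_mem (valP b).
rewrite [from_freeg _]freeg_extendU (root_generatorE bE) to_freeg_quot.
rewrite to_wreath_pure_conj to_wreath_gen /= freeg_act_class;
  last exact: alpha_root.
by rewrite -bE root_class_val.
Qed.

End Abelianization.

Theorem proposition2p13 (R : realType) (S : finType) (M : coxeterMatrix S) :
  free_abelian_of_rank (abelianization (pure_virtual_artin M))
                       (root_system R M).
Proof.
exists (@to_freeg R S M); split; last exact: to_freegM.
exact: Bijective (@to_freegK R S M) (@from_freegK R S M).
Qed.
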